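(* Let $\mathfrak h^2$ be the space of noncommutative polynomials, $\stackrel{\vec t}{\ast}$ and $\ast$ the (commutative) products on it, and $S^{\vec t}$ the multi-interpolation operator, all as defined in the context. The map $S^{\vec t}$ is an isomorphism from $(\mathfrak h^2,\stackrel{\vec t}{\ast})$ to $(\mathfrak h^2,\ast)$; that is, $S^{\vec t}:\mathfrak h^2\to\mathfrak h^2$ is a linear bijection such that for all $x,y\in\mathfrak h^2$ $$S^{\vec t}(x\stackrel{\vec t}{\ast}y)=S^{\vec t}(x)\ast S^{\vec t}(y).$$ The map $Z^{\vec t}$ decomposes as $Z^{\vec t}=Z\circ S^{\vec t}$ on $\mathfrak h^2$. Moreover, for all $x,y\in\mathfrak h^2$, $$Z^{\vec t}(x\stackrel{\vec t}{\ast}y)=Z^{\vec t}(x)\cdot Z^{\vec t}(y).$$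
   Context: Let $\mathcal A=\{z_1,z_2,\dots\}$ be a countable set of letters and $\vec t$ a further symbol not commuting with the letters $z_i$. In the free noncommutative algebra $\mathbb Q\langle\mathcal A,\vec t\,\rangle$ let $\mathfrak H$ be the $\mathbb Q$-span of the empty word $1$ and all words not ending in $\vec t$, i.e. words $\vec t^{\,m_1}z_{i_1}\vec t^{\,m_2}z_{i_2}\cdots\vec t^{\,m_n}z_{i_n}$ with $n\ge1$, $m_j\ge 0$, $i_j\ge1$. Let $\mathfrak h^2\subset\mathfrak H$ be the span of $1$ and those words with $i_1\ne 1$. All operations below are $\mathbb Q$-(bi)linear and defined recursively on $\mathfrak H$; they restrict to $\mathfrak h^2$. Powers of $\vec t$ multiply from the left by concatenation. Product $\diamond$: $\vec t^{\,c}z_i\diamond\vec t^{\,d}z_j=\vec t^{\,c+d}z_{i+j}$; more generally a letter acts on the first letter of a word, $\vec t^{\,c}a\diamond(\vec t^{\,d}b\,w)=\vec t^{\,c+d}(a\diamond b)\,w$ for $a,b\in\mathcal A$, $w\in\mathfrak H$, and $\vec t^{\,c}a\diamond 1=0$. The expression $a\diamond b\diamond w$ means $(a\diamond b)\diamond w$. Stuffle product $\ast$: $x\ast1=1\ast x=x$, and for $x=\vec t^{\,m}a\,u$, $y=\vec t^{\,k}b\,v$ with $m,k\ge0$, $a,b\in\mathcal A$, $u,v$ words in $\mathfrak H$, $$x\ast y=\vec t^{\,m}a(u\ast y)+\vec t^{\,k}b(x\ast v)+\vec t^{\,m+k}(a\diamond b)(u\ast v).$$ Product $\stackrel{\vec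 t}{\ast}$: $x\stackrel{\vec t}{\ast}1=1\stackrel{\vec t}{\ast}x=x$, and for $x=\vec t^{\,m}a\,u$, $y=\vec t^{\,k}b\,v$ with $m,k\ge0$, $a,b\in\mathcal A$, $u,v$ words in $\mathfrak H$, $$x\stackrel{\vec t}{\ast}y=\vec t^{\,m}a(u\stackrel{\vec t}{\ast}y)+\vec t^{\,k}b(x\stackrel{\vec t}{\ast}v)+(1-2\vec t\,)\vec t^{\,m+k}(a\diamond b)(u\stackrel{\vec t}{\ast}v)+(\vec t^{\,2}-\vec t\,)\vec t^{\,m+k}\,a\diamond b\diamond(u\stackrel{\vec t}{\ast}v).$$ Multi-interpolation operator: $S^{\vec t}(1)=1$, $S^{\vec t}(\vec t^{\,m}a)=\vec t^{\,m}a$ for $a\in\mathcal A$, and $S^{\vec t}(\vec t^{\,m}a\,u)=\vec t^{\,m}a\,S^{\vec t}(u)+\vec t^{\,m+1}a\diamond S^{\vec t}(u)$. Evaluation maps: to the symbol $\vec t$ one associates a sequence $(t_1,t_2,\dots)$ of variables, $t_j\in[-1,1]$. The linear maps $Z$ and $Z^{\vec t}$ on $\mathfrak h^2$ are given by $Z(1)=Z^{\vec t}(1)=1$ and, for $x=\vec t^{\,m_1}z_{i_1}\cdots\vec t^{\,m_n}z_{i_n}$ with $i_1\geq 2$, $$Z(x)=\sum_{\ell_1>\cdots>\ell_n\ge1}\frac{t_{\ell_1}^{m_1}\cdots t_{\ell_n}^{m_n}}{\ell_1^{i_1}\cdots\ell_n^{i_n}},\qquad Z^{\vec t}(x)=\sum_{\ell_1\ge\cdots\ge\ell_n\ge1}\Big(\prod_{j\ge1}t_j^{\sigma_j(\ell_1,\dots,\ell_n)}\Big)\frac{t_{\ell_1}^{m_1}\cdots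 t_{\ell_n}^{m_n}}{\ell_1^{i_1}\cdots\ell_n^{i_n}},$$ where $\sigma_j(\ell_1,\dots,\ell_n)=|\{1\le r\le n-1:\ \ell_r=\ell_{r+1}=j\}|$ and $t_j^0=1$. The identities for $Z$ and $Z^{\vec t}$ are asserted for every such sequence. *)

(* Defs.v *)
(* MathComp / MathComp-Analysis.  monalg has to be loaded before the analysis
   library: in the other order their notations clash. *)
From HB Require Import structures.
From mathcomp Require Export all_boot all_order all_algebra finmap monalg.
From mathcomp Require Export all_classical all_reals all_analysis.
From mathcomp Require Export summability.

Set Implicit Arguments.
Unset Strict Implicit.
Unset Printing Implicit Defensive.

Export Order.TTheory GRing.Theory Num.Theory.
Export numFieldNormedType.Exports.

Local Open Scope classical_set_scope.
Local Open Scope ring_scope.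

(** * Letters, words and the free algebra *)

(* [i : letter] stands for the letter z_i, i >= 1. *)
Definition letter : choiceType := {i : nat | (0 < i)%N}.

Lemma diamond_letter_subproof (a b : letter) : (0 < val a + val b)%N.
Proof. by rewrite addn_gt0 (valP a). Qed.

(* z_i diamond z_j = z_(i+j) *)
Definition diamond_letter (a b : letter) : letter :=
  exist _ (val a + val b)%N (diamond_letter_subproof a b).

(* [Some i] is the letter z_i and [None] is the extra symbol t. *)
Definition symbol : choiceType := option letter.

(* The free noncommutative algebra Q<z_1, z_2, ..., t>: the monoid algebra over
   rat of the free monoid on the symbols; its product is concatenation. *)
Definition freeAlg := {malg rat[{fmonom symbol}]}.

Definition tsym : freeAlg := << FMonom [:: None] >>.
Definition zsym (a : letter) : freeAlg := << FMonom [:: Some a] >>.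

(* A word t^m1 z_i1 ... t^mn z_in of H is determined by its list of blocks
   [:: (m1, i1); ...; (mn, in)]; the empty list gives the empty word. *)
Definition block : choiceType := (nat * letter)%type.

Definition word (s : seq block) : {fmonom symbol} :=
  FMonom (flatten [seq rcons (nseq p.1 None) (Some p.2) | p <- s]).

(* Inverse of [word].  The value on words ending in t, where the trailing t's
   are dropped, is irrelevant: such words are not in H. *)
Fixpoint blocks_rec (m : nat) (w : seq symbol) : seq block :=
  match w with
  | [::] => [::]
  | None :: w' => blocks_rec m.+1 w'
  | Some a :: w' => (m, a) :: blocks_rec 0 w'
  end.

Definition blocks (w : {fmonom symbol}) : seq block := blocks_rec 0 w.

Definition admissible (s : seq block) : bool :=
  if s is (_, a) :: _ then val a != 1%N else true.

Definition h2 : set freeAlg :=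
  [set x : freeAlg | forall w, w \in msupp x ->
     exists2 s : seq block, admissible s & w = word s].

(** * Products and the operator S, by linear extension from words of H *)

Definition lin_ext (f : seq block -> freeAlg) (x : freeAlg) : freeAlg :=
  \sum_(w <- msupp x) x@_w *: f (blocks w).

Definition bilin_ext (f : seq block -> seq block -> freeAlg)
    (x y : freeAlg) : freeAlg :=
  \sum_(u <- msupp x) \sum_(v <- msupp y)
     (x@_u * y@_v) *: f (blocks u) (blocks v).

(* [diamond c a x] is t^c z_a diamond x. *)
Definition diamond (c : nat) (a : letter) : freeAlg -> freeAlg :=
  lin_ext (fun s =>
    if s is (d, b) :: w
    then tsym ^+ (c + d) * zsym (diamond_letter a b) * << word w >>
    else 0).

Fixpoint stuffle_word (x : seq block) : seq block -> freeAlg :=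
  match x with
  | [::] => fun y => << word y >>
  | (m, a) :: u =>
      fix stuffle_x (y : seq block) : freeAlg :=
        match y with
        | [::] => << word x >>
        | (k, b) :: v =>
            tsym ^+ m * zsym a * stuffle_word u y
            + tsym ^+ k * zsym b * stuffle_x v
            + tsym ^+ (m + k) * zsym (diamond_letter a b) * stuffle_word u v
        end
  end.

Definition stuffle : freeAlg -> freeAlg -> freeAlg := bilin_ext stuffle_word.

Fixpoint tstuffle_word (x : seq block) : seq block -> freeAlg :=
  match x with
  | [::] => fun y => << word y >>
  | (m, a) :: u =>
      fix tstuffle_x (y : seq block) : freeAlg :=
        match y with
        | [::] => << word x >>
        | (k, b) :: v =>
            tsym ^+ m * zsym a * tstuffle_word u y
            + tsym ^+ k * zsym b * tstuffle_x v
            + (1 - 2 *: tsym) * tsym ^+ (m + k) * zsym (diamond_letter a b)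
                * tstuffle_word u v
            + (tsym ^+ 2 - tsym) * tsym ^+ (m + k)
                * diamond 0 (diamond_letter a b) (tstuffle_word u v)
        end
  end.

Definition tstuffle : freeAlg -> freeAlg -> freeAlg := bilin_ext tstuffle_word.

Fixpoint interp_word (x : seq block) : freeAlg :=
  match x with
  | [::] => 1
  | [:: (m, a)] => tsym ^+ m * zsym a
  | (m, a) :: u =>
      tsym ^+ m * zsym a * interp_word u + diamond m.+1 a (interp_word u)
  end.

Definition interp : freeAlg -> freeAlg := lin_ext interp_word.

(** * Evaluation maps *)

Section Evaluation.
Variables (R : realType) (t : nat -> R).

(* t_{l_1}^m_1 ... t_{l_n}^m_n / (l_1^i_1 ... l_n^i_n) *)
Definition zeta_term (s : seq block) (l : seq nat) : R :=
  \prod_(p <- zip s l) (t p.2 ^+ p.1.1 / p.2%:R ^+ val p.1.2).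

(* The number of r with l_r = l_(r+1) = j. *)
Definition sigma (j : nat) (l : seq nat) : nat :=
  #|[pred r : 'I_(size l).-1 | (nth 0 l r == j) && (nth 0 l r.+1 == j)]%N|.

Definition strict_index (n : nat) : choiceType :=
  {l : seq nat | [&& size l == n, sorted gtn l & all (ltn 0) l]}.

Definition weak_index (n : nat) : choiceType :=
  {l : seq nat | [&& size l == n, sorted geq l & all (ltn 0) l]}.

(* [sum] is the unconditional sum over the index type, i.e. the limit of the
   partial sums along the directed set of finite subsets.  For [s = [::]] the
   only index is the empty sequence, and both sums are 1. *)
Definition Z_word (s : seq block) : R :=
  sum (fun l : strict_index (size s) => zeta_term s (val l) : R^o).

(* The product over j >= 1 has finite support, as sigma j l = 0 for j not in
   l. *)
Definition Zt_word (s : seq block) : R :=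
  sum (fun l : weak_index (size s) =>
    (\big[*%R/1]_(j \in [set j | (0 < j)%N]) t j ^+ sigma j (val l))
      * zeta_term s (val l) : R^o).

Definition Z (x : freeAlg) : R :=
  \sum_(w <- msupp x) ratr x@_w * Z_word (blocks w).

Definition Zt (x : freeAlg) : R :=
  \sum_(w <- msupp x) ratr x@_w * Zt_word (blocks w).

End Evaluation.

(* Main.v *)
(* Write L_p for left concatenation of the block p = t^m z_i, D_p for
   p diamond _ and E_p = L_p + D_(tp), so that S L_p = E_p S and S D_p = D_p S.
   The operator T with T L_p = (L_p - D_(tp)) T, which also commutes with the
   D_p, inverts S.  By induction on the words, the homomorphism property reduces
   to the identity
     E_p x * E_q y + 2 L_(tpq) (x * y) + D_(ttpq) (x * y)
       = E_p (x * E_q y) + E_q (E_p x * y) + L_(pq) (x * y),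
   which is bilinear and follows on words from one unfolding of the stuffle
   product.  The analytic part truncates all summation indices at N: the
   truncation Z_N is multiplicative for the stuffle product and satisfies
   Z_N o S = Z^t_N, both by induction on N from the recurrence
     Z_(N+1)(L_p w) = Z_N(L_p w) + p(N+1) Z_N(w),
   and absolute convergence lets N tend to infinity. *)
From HB Require Import structures.
Require Import Defs.
From mathcomp Require Import ring lra zify.

Set Implicit Arguments.
Unset Strict Implicit.
Unset Printing Implicit Defensive.

Local Open Scope classical_set_scope.
Local Open Scope ring_scope.

(** * Words, blocks and left concatenation *)

Lemma blocks_rec_cat m p (w : seq symbol) :
  blocks_rec m (rcons (nseq p.1 None) (Some p.2) ++ w) =
  ((m + p.1)%N, p.2) :: blocks_rec 0 w.
Proof.
case: p => k a /=; elim: k m => [|k IH] m /=; first by rewrite addn0.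
by rewrite IH addSnnS.
Qed.

Lemma wordK : cancel word blocks.
Proof.
rewrite /blocks; elim=> [|[k a] s IH] //=.
by rewrite (blocks_rec_cat 0 (k, a)) /= IH.
Qed.

Definition wd (s : seq block) : freeAlg := << word s >>.

Definition catl (p : block) (x : freeAlg) : freeAlg :=
  tsym ^+ p.1 * zsym p.2 * x.

Lemma monomM (u v : seq symbol) :
  << FMonom u >> * << FMonom v >> = << FMonom (u ++ v) >> :> freeAlg.
Proof. by rewrite malgM_def fgmulUU mulr1 -[mmul _ _]fmK fmM. Qed.

Lemma monalgUZ (c a : rat) (k : {fmonom symbol}) :
  << c * a *g k >> = c *: << a *g k >> :> freeAlg.
Proof. by apply/malgP => k'; rewrite mcoeffZ [LHS]mcoeffU mcoeffU mulrnAr. Qed.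

(** Scalars pass the left factor because [rat] is commutative; this makes [catl p] linear. *)
Lemma mulr_scaler (c : rat) (x y : freeAlg) : x * (c *: y) = c *: (x * y).
Proof.
rewrite (malgMEw (fsubset_refl _) (msuppZ_le c y)) malgME scaler_sumr.
apply: eq_bigr => i _; rewrite scaler_sumr; apply: eq_bigr => j _.
by rewrite mcoeffZ mulrCA monalgUZ.
Qed.

Lemma fm1E : << FMonom [::] >> = 1 :> freeAlg.
Proof. by rewrite -fm1 fmK. Qed.

Lemma tsymX n : tsym ^+ n = << FMonom (nseq n None) >>.
Proof.
elim: n => [|n IH]; first by rewrite expr0 -fm1E.
by rewrite exprS IH monomM.
Qed.

Lemma catl_wd p s : catl p (wd s) = wd (p :: s).
Proof.
by rewrite /catl /wd tsymX !monomM cats1.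
Qed.

Lemma wd_nil : wd [::] = 1.
Proof. by rewrite -fm1E. Qed.

Lemma catl_is_linear p : linear (catl p).
Proof. by move=> c x y; rewrite /catl mulrDr mulr_scaler. Qed.
HB.instance Definition _ p :=
  GRing.isLinear.Build rat freeAlg freeAlg *:%R (catl p) (catl_is_linear p).

(** * Linear extension *)

Lemma msupp_sum_incl (V : zmodType) (F : {fmonom symbol} -> rat -> V)
    (d : {fset {fmonom symbol}}) (x : freeAlg) :
  (forall w, F w 0 = 0) -> (msupp x `<=` d)%fset ->
  \sum_(w <- msupp x) F w x@_w = \sum_(w <- d) F w x@_w.
Proof.
by move=> F0 sub; apply: big_fset_incl => // w _ /mcoeff_outdom ->.
Qed.

(** The scalar action [G] is kept general, to cover both [*:%R] on the free algebra and
    multiplication by [ratr c] on the reals. All three sums are moved to the union of the two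
    supports, where the added terms are 0. *)
Lemma msupp_sum_linear (V : zmodType) (F : {fmonom symbol} -> rat -> V)
    (G : rat -> V -> V) (c : rat) (x y : freeAlg) :
    (forall w a b, F w (c * a + b) = G c (F w a) + F w b) ->
    {morph G c : u v / u + v} -> G c 0 = 0 -> (forall w, F w 0 = 0) ->
  \sum_(w <- msupp (c *: x + y)) F w (c *: x + y)@_w =
  G c (\sum_(w <- msupp x) F w x@_w) + \sum_(w <- msupp y) F w y@_w.
Proof.
move=> FD GD G0 F0; pose d := (msupp x `|` msupp y)%fset.
rewrite (@msupp_sum_incl _ F d (c *: x + y)) //; last first.
  apply: fsubset_trans (msuppD_le _ _) _.
  by apply: fsetUSS => //; exact: msuppZ_le.
rewrite (@msupp_sum_incl _ F d x) ?fsubsetUl //.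
rewrite (@msupp_sum_incl _ F d y) ?fsubsetUr //.
rewrite (big_morph (G c) GD G0) -big_split /=.
by apply: eq_bigr => w _; rewrite mcoeffD mcoeffZ FD.
Qed.

Lemma lin_ext_is_linear f : linear (lin_ext f).
Proof.
move=> c x y; rewrite /lin_ext.
apply: (@msupp_sum_linear _ (fun w a => a *: f (blocks w)) *:%R) => *.
- by rewrite scalerDl scalerA.
- exact: scalerDr.
- exact: scaler0.
- exact: scale0r.
Qed.
HB.instance Definition _ f := GRing.isLinear.Build rat freeAlg freeAlg *:%R
  (lin_ext f) (lin_ext_is_linear f).

Lemma lin_ext_wd f s : lin_ext f (wd s) = f s.
Proof.
by rewrite /lin_ext msuppU1 big_seq_fset1 mcoeffUU scale1r wordK.
Qed.

HB.instance Definition _ c a := GRing.Linear.copy (diamond c a) (lin_ext _).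
HB.instance Definition _ := GRing.Linear.copy interp (lin_ext interp_word).

Lemma lin_ext_comp (h : {linear freeAlg -> freeAlg}) f x :
  h (lin_ext f x) = lin_ext (h \o f) x.
Proof.
by rewrite /lin_ext linear_sum; apply: eq_bigr => w _; rewrite linearZ.
Qed.

Lemma eq_lin_ext f g : f =1 g -> lin_ext f =1 lin_ext g.
Proof. by move=> fg x; apply: eq_bigr => w _; rewrite fg. Qed.

Lemma bilin_extl f x y :
  bilin_ext f x y = lin_ext (fun u => lin_ext (f u) y) x.
Proof.
apply: eq_bigr => u _; rewrite /lin_ext scaler_sumr.
by apply: eq_bigr => v _; rewrite scalerA.
Qed.

Lemma bilin_extr f x y :
  bilin_ext f x y = lin_ext (fun v => lin_ext (f^~ v) x) y.
Proof.
rewrite /bilin_ext exchange_big; apply: eq_bigr => v _.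
rewrite /lin_ext scaler_sumr.
by apply: eq_bigr => u _; rewrite scalerA mulrC.
Qed.

Lemma bilin_ext_linearl f y : linear ((bilin_ext f)^~ y).
Proof. by move=> c u v; rewrite !bilin_extl linearP. Qed.

Lemma bilin_ext_linearr f x : linear (bilin_ext f x).
Proof. by move=> c u v; rewrite !bilin_extr linearP. Qed.

Lemma bilin_ext_wd f u v : bilin_ext f (wd u) (wd v) = f u v.
Proof. by rewrite bilin_extl !lin_ext_wd. Qed.

(** * Spans of words *)

Definition spanned (D : pred (seq block)) (x : freeAlg) : Prop :=
  forall w, w \in msupp x -> exists2 s, D s & w = word s.

Section Spanned.
Variable D : pred (seq block).

Lemma spanned0 : spanned D 0.
Proof. by move=> w; rewrite msupp0. Qed.

Lemma spannedP c x y : spanned D x -> spanned D y -> spanned D (c *: x + y).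
Proof.
move=> Dx Dy w /(fsubsetP (msuppD_le _ _)); rewrite in_fsetU.
case/orP; last exact: Dy.
by move/(fsubsetP (msuppZ_le _ _)); exact: Dx.
Qed.

Lemma spannedD x y : spanned D x -> spanned D y -> spanned D (x + y).
Proof. by move=> Dx Dy; rewrite -[x]scale1r; exact: spannedP. Qed.

Lemma spannedZ c x : spanned D x -> spanned D (c *: x).
Proof.
move=> Dx; rewrite -[_ *: _]addr0.
by apply: spannedP => //; exact: spanned0.
Qed.

Lemma spannedB x y : spanned D x -> spanned D y -> spanned D (x - y).
Proof.
move=> Dx Dy; rewrite -scaleN1r.
by apply: spannedD => //; exact: spannedZ.
Qed.

Lemma spanned_wd s : D s -> spanned D (wd s).
Proof. by move=> Ds w; rewrite msuppU1 in_fset1 => /eqP ->; exists s. Qed.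

Lemma spanned_sum (I : choiceType) (r : seq I) (F : I -> freeAlg) :
  {in r, forall i, spanned D (F i)} -> spanned D (\sum_(i <- r) F i).
Proof.
move=> DF; rewrite big_seq; apply: big_ind => //; first exact: spanned0.
exact: spannedD.
Qed.

Lemma spanned_lin_ext f (D' : pred (seq block)) x :
  (forall s, D' s -> spanned D (f s)) ->
  spanned D' x -> spanned D (lin_ext f x).
Proof.
move=> Df D'x; apply: spanned_sum => w /D'x [s Ds ->].
by rewrite wordK; apply/spannedZ/Df.
Qed.

(** A linear map is determined by its values on the words in the support. The maps are plain
    functions, so that composite expressions need no bundled structure. *)
Lemma eq_spanned (f g : freeAlg -> freeAlg) : linear f -> linear g ->
  (forall s, D s -> f (wd s) = g (wd s)) -> forall x, spanned D x -> f x = g x.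
Proof.
have expand (h : freeAlg -> freeAlg) : linear h ->
    forall x, h x = \sum_(w <- msupp x) x@_w *: h << w >>.
  move=> lh x; pose h' := GRing.isLinear.Build _ _ _ _ h lh.
  pose H : {linear freeAlg -> freeAlg} := HB.pack h h'.
  rewrite -[h]/(H : _ -> _) [in LHS](monalgE x) linear_sum.
  apply: eq_bigr => w _.
  by rewrite -[x@_w in LHS]mulr1 monalgUZ linearZ.
move=> lf lg fg x Dx; rewrite [LHS](expand f lf) [RHS](expand g lg).
rewrite big_seq [RHS]big_seq.
by apply: eq_bigr => w /Dx [s Ds ->]; rewrite [f _]fg.
Qed.

Lemma spanned_bilin f (D1 D2 : pred (seq block)) x y :
    (forall u v, D1 u -> D2 v -> spanned D (f u v)) ->
  spanned D1 x -> spanned D2 y -> spanned D (bilin_ext f x y).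
Proof.
move=> Df D1x D2y; rewrite bilin_extl; apply: spanned_lin_ext D1x => u D1u.
by apply: spanned_lin_ext D2y => v D2v; exact: Df.
Qed.

End Spanned.

Notation spannedT := (spanned xpredT).

Lemma sub_spanned (D D' : pred (seq block)) x :
  {subset D <= D'} -> spanned D x -> spanned D' x.
Proof. by move=> sub Dx w /Dx[s Ds ->]; exists s => //; exact: sub. Qed.

Lemma spanned_catl (D : pred (seq block)) p x :
  spannedT x -> (forall s, D (p :: s)) -> spanned D (catl p x).
Proof.
move=> Hx Dp; rewrite (_ : x = lin_ext wd x).
  rewrite lin_ext_comp; apply: spanned_lin_ext Hx => s _ /=.
  by rewrite catl_wd; exact: spanned_wd.
apply: (@eq_spanned xpredT id (lin_ext wd)) => //; first exact: linearP.
by move=> s _; rewrite lin_ext_wd.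
Qed.

(** * Operators attached to blocks *)

Definition bmul (p q : block) : block :=
  ((p.1 + q.1)%N, diamond_letter p.2 q.2).

Definition tmul (p : block) : block := (p.1.+1, p.2).

Definition dia (p : block) : freeAlg -> freeAlg := diamond p.1 p.2.
HB.instance Definition _ p := GRing.Linear.copy (dia p) (diamond p.1 p.2).

Lemma bmulA p q r : bmul (bmul p q) r = bmul p (bmul q r).
Proof. by congr pair; [rewrite /= addnA|apply: val_inj; rewrite /= addnA]. Qed.

Lemma bmulC p q : bmul p q = bmul q p.
Proof. by congr pair; [rewrite /= addnC|apply: val_inj; rewrite /= addnC]. Qed.

Lemma bmul_tr p q : bmul p (tmul q) = tmul (bmul p q).
Proof. by congr pair; rewrite /= addnS. Qed.

Lemma dia_nil p : dia p (wd [::]) = 0.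
Proof. by rewrite /dia /diamond lin_ext_wd. Qed.

Lemma dia_wd p q s : dia p (wd (q :: s)) = wd (bmul p q :: s).
Proof.
by rewrite /dia /diamond lin_ext_wd; case: q => k b; rewrite -catl_wd.
Qed.

Lemma diaE p x : dia p x =
  lin_ext (fun s => if s is q :: w then wd (bmul p q :: w) else 0) x.
Proof.
apply: eq_lin_ext => -[//|[k b] w].
by rewrite -[LHS]/(catl (bmul p (k, b)) (wd w)) catl_wd.
Qed.

Lemma spanned_dia (D : pred (seq block)) p x :
  (forall q s, D (bmul p q :: s)) -> spannedT x -> spanned D (dia p x).
Proof.
move=> Dp Hx; rewrite diaE; apply: spanned_lin_ext Hx => -[|q s] _.
  exact: spanned0.
exact: spanned_wd.
Qed.

(** The span hypothesis matters: [dia] reads its argument through [blocks], which drops a trailing t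
    that [catl] keeps. *)
Lemma dia_catl p q x : spannedT x -> dia p (catl q x) = catl (bmul p q) x.
Proof.
apply: (@eq_spanned xpredT (dia p \o catl q)) => [c u v|c u v|s _] /=;
  rewrite ?linearP //.
by rewrite !catl_wd dia_wd.
Qed.

Lemma dia_dia p q x : dia p (dia q x) = dia (bmul p q) x.
Proof.
rewrite diaE [RHS]diaE diaE -diaE lin_ext_comp; apply: eq_lin_ext => -[|r s] /=.
  by rewrite linear0.
by rewrite dia_wd bmulA.
Qed.

(** * The interpolation operator *)

(* [c = 1] gives S and [c = -1] its inverse. *)
Fixpoint interpc_word (c : rat) (s : seq block) : freeAlg :=
  if s is p :: u then
    catl p (interpc_word c u) + c *: dia (tmul p) (interpc_word c u)
  else 1.

Definition interpc c : freeAlg -> freeAlg := lin_ext (interpc_word c).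
HB.instance Definition _ c :=
  GRing.Linear.copy (interpc c) (lin_ext (interpc_word c)).

(** [interp_word] treats a single block separately; the uniform recursion agrees with it because the
    diamond with the empty word is 0. *)
Lemma interpE : interp =1 interpc 1.
Proof.
apply: eq_lin_ext; elim=> [//|[m a] [|q s] IH].
  by rewrite /= scale1r -wd_nil dia_nil addr0 wd_nil /catl mulr1.
rewrite -[RHS]/(catl (m, a) (interpc_word 1 (q :: s)) +
  1 *: dia (tmul (m, a)) (interpc_word 1 (q :: s))) -IH.
by rewrite [1 *: _]scale1r.
Qed.

Lemma interpc_spanned c s : spannedT (interpc_word c s).
Proof.
elim: s => [|p s IH] /=; first by rewrite -wd_nil; exact: spanned_wd.
apply: spannedD; first exact: spanned_catl.
by apply/spannedZ/spanned_dia.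
Qed.

Lemma spanned_interpc c x : spannedT x -> spannedT (interpc c x).
Proof. by apply: spanned_lin_ext => s _; exact: interpc_spanned. Qed.

Lemma interpc_wd c p s : interpc c (wd (p :: s)) =
  catl p (interpc c (wd s)) + c *: dia (tmul p) (interpc c (wd s)).
Proof. by rewrite /interpc !lin_ext_wd. Qed.

Lemma interpc_catl c p x : spannedT x -> interpc c (catl p x) =
  catl p (interpc c x) + c *: dia (tmul p) (interpc c x).
Proof.
apply: (@eq_spanned xpredT (interpc c \o catl p)
  (fun x => catl p (interpc c x) + c *: dia (tmul p) (interpc c x))).
- by move=> a u v /=; rewrite !linearP.
- by move=> a u v; rewrite !linearP /= [a *: (_ + _)]scalerDr addrACA.
- by move=> s _; rewrite [LHS]/= catl_wd interpc_wd.
Qed.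

(** The operator D_p only changes the first block q into pq, and p(tq) = t(pq), so it passes both
    terms of the recursion. *)
Lemma interpc_dia c p x : interpc c (dia p x) = dia p (interpc c x).
Proof.
rewrite diaE !lin_ext_comp; apply: eq_lin_ext => -[|q s] /=.
  by rewrite linear0 -wd_nil dia_nil.
rewrite interpc_wd /interpc lin_ext_wd [RHS]linearD linearZ /=.
by rewrite dia_catl ?dia_dia ?bmul_tr //; exact: interpc_spanned.
Qed.

(** Induction on the word: as [interpc c] commutes with D_(tp), it turns L_p - c D_(tp) into L_p + c
    D_(tp) - c D_(tp). *)
Lemma interpcK c x : spannedT x -> interpc c (interpc (- c) x) = x.
Proof.
apply: (@eq_spanned xpredT (interpc c \o interpc (- c)) idfun)
  => [a u v|//|s _] /=.
  by rewrite !linearP.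
elim: s => [|p s IH].
  by rewrite /interpc lin_ext_wd /= -wd_nil lin_ext_wd wd_nil.
rewrite interpc_wd linearD /= linearZ /= interpc_catl; last first.
  exact/spanned_interpc/spanned_wd.
by rewrite interpc_dia IH catl_wd scaleNr addrK.
Qed.

(** Indices are at least 1, so a sum of two of them is never 1. This is why diamond products stay in
    [h2]. *)
Lemma admissible_bmul p q s : admissible (bmul p q :: s).
Proof. by case: p q => [m [i +]] [k [j +]] /=; lia. Qed.

Lemma h2T x : h2 x -> spannedT x.
Proof. exact: sub_spanned. Qed.

Lemma h2_interpc c x : h2 x -> h2 (interpc c x).
Proof.
apply: (@spanned_lin_ext admissible _ admissible) => -[|p s] ps /=.
  by rewrite -wd_nil; exact: spanned_wd.
apply: spannedD; first by apply: spanned_catl => //; exact: interpc_spanned.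
apply/spannedZ/spanned_dia; last exact: interpc_spanned.
exact: admissible_bmul p.
Qed.

Lemma interp_bij : set_bij h2 h2 interp.
Proof.
split=> [x Hx|x y /set_mem Hx /set_mem Hy|y Hy].
- by rewrite interpE; exact: h2_interpc.
- rewrite !interpE => /(congr1 (interpc (-1))).
  by rewrite -{1 3}[1]opprK !interpcK //; exact: h2T.
- exists (interpc (-1) y); first exact: h2_interpc.
  by rewrite interpE interpcK //; exact: h2T.
Qed.

(** * Cancelling summands up to reordering *)

Section Summands.
Variable V : zmodType.
Implicit Types x y r s l : V.

Lemma summand_here x r : x + r = x + r. Proof. by []. Qed.

Lemma summand_there x y r s : r = x + s -> y + r = x + (y + s).
Proof. by move=> ->; rewrite addrCA. Qed.

Lemma summand_last x : x = x + 0. Proof. by rewrite addr0. Qed.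

Lemma cancel_summand x l r s : r = x + s -> l = s -> x + l = r.
Proof. by move=> -> ->. Qed.

End Summands.

(** [sum_ac] strips the summands of the left side one by one: [find_summand] locates the current one
    on the right and instantiates the remainder, an existential variable, by what is left over. *)
Ltac find_summand := first
  [ apply summand_here
  | apply summand_there; find_summand
  | apply summand_last ].

Ltac sum_ac := rewrite -?addrA;
  repeat (eapply cancel_summand; [find_summand|]);
  rewrite ?addr0; reflexivity.

(** * The key identity for the stuffle product, in abstract form *)

Section StuffleIdentity.
Variables (B : Type) (mul : B -> B -> B) (t : B -> B) (V : zmodType).
Variables (w : seq B -> V) (L D : B -> V -> V) (st : V -> V -> V).
Hypotheses (mulA : associative mul) (mulC : commutative mul).
Hypothesis (mul_t : forall p q, mul p (t q) = t (mul p q)).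
Hypotheses (LD : forall p, {morph L p : x y / x + y}).
Hypotheses (DD : forall p, {morph D p : x y / x + y}).
Hypotheses (stDl : forall z, {morph st^~ z : x y / x + y}).
Hypotheses (stDr : forall z, {morph st z : x y / x + y}).
Hypotheses (Lw : forall p s, L p (w s) = w (p :: s)).
Hypotheses (Dw : forall p q s, D p (w (q :: s)) = w (mul p q :: s)).
Hypotheses (D0 : forall p, D p (w [::]) = 0).
Hypothesis (DL : forall p q u v,
  D p (L q (st (w u) (w v))) = L (mul p q) (st (w u) (w v))).
Hypotheses (st0 : forall v, st (w [::]) (w v) = w v).
Hypotheses (str0 : forall v, st (w v) (w [::]) = w v).
Hypothesis (stw : forall p q u v, st (w (p :: u)) (w (q :: v)) =
  L p (st (w u) (w (q :: v))) + L q (st (w (p :: u)) (w v))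
  + L (mul p q) (st (w u) (w v))).

Let mul_tl p q : mul (t p) q = t (mul p q).
Proof. by rewrite mulC mul_t mulC. Qed.

Let mulCA p q r : mul p (mul q r) = mul q (mul p r).
Proof. by rewrite !mulA [mul p q]mulC. Qed.

Let addt p x := L p x + D (t p) x.

(** Once the stuffle products are unfolded, both sides are the same sum up to order. Empty words
    form separate cases because D sends the empty word to 0. *)
Lemma stuffle_addt_words p q u v :
  st (addt p (w u)) (addt q (w v)) + L (t (mul p q)) (st (w u) (w v)) *+ 2
    + D (t (t (mul p q))) (st (w u) (w v)) =
  addt p (st (w u) (addt q (w v))) + addt q (st (addt p (w u)) (w v))
    + L (mul p q) (st (w u) (w v)).
Proof.
rewrite /addt mulr2n; case: u v => [|r u] [|s v].
- rewrite !(D0, addr0, Lw, stw, st0, str0, Dw, mul_t, mul_tl) [mul q p]mulC.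
  by sum_ac.
- rewrite !(D0, addr0, Lw, Dw, stDr, stw, st0, mul_tl).
  rewrite !(LD, DD, Lw, Dw, DL, mul_t, mul_tl).
  rewrite [mul q p]mulC -!mulA [mul q (mul p s)]mulC -!mulA [mul s q]mulC.
  by sum_ac.
- rewrite !(D0, addr0, Lw, Dw, stDl, stw, str0, mul_t, mul_tl).
  rewrite !(LD, DD, Lw, Dw, DL, mul_t, mul_tl).
  rewrite [mul q p]mulC [mul q (mul p r)]mulC -!mulA [mul r q]mulC.
  by sum_ac.
rewrite !Lw !Dw.
have DX a b : D a (L b (st (w (r :: u)) (w (s :: v)))) =
    L (mul a b) (st (w (r :: u)) (w (s :: v))) by exact: DL.
rewrite !(stDl, stDr, mul_t, mul_tl) !(stw p, stw (t _), stw r (t _), stw r q).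
(* The product [X] of the two given words stays an atom; it is unfolded only under D_(ttpq), where D
   has to reach the leading blocks. *)
move: DX (stw r s u v); move: (st (w (r :: u)) (w (s :: v))) => X DX EX.
rewrite !(LD, DD) !DX [in D (t (t _)) X]EX !(LD, DD, DL, mul_t, mul_tl).
rewrite [mul q p]mulC -!mulA [mul q (mul p r)]mulC [mul q (mul p s)]mulC.
rewrite [mul q (mul p (mul r s))]mulC -!mulA [mul s q]mulC [mul r q]mulC.
rewrite [mul r (mul q s)]mulCA.
by sum_ac.
Qed.
End StuffleIdentity.

(** * Signed sums, and the recurrences of the products on words *)

Lemma sub_summands (V : zmodType) (a b l d l1 d2 x : V) :
  x + l1 *+ 2 + d2 = a + b + l ->
  a + b + (l + d) - (l1 + d2) *+ 2 + d2 - d = x.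
Proof.
move=> e; have -> : x = a + b + l - d2 - l1 *+ 2 by rewrite -e !addrK.
rewrite (addrA _ l) mulrnDl (mulr2n d2) !opprD !addrA subrK.
by rewrite 3!(addrAC _ d) addrK 2!(addrAC _ (- l1) (- d2)).
Qed.

(** Meant for [f] = S applied to the six-term recurrence of [tstuffle_word]: the images of [c] and
    [e] are E_(pq) and E_(tpq) of one product. The D_(tpq) terms cancel, a single -D_(ttpq)
    survives, and the hypothesis on [x] is the key identity. *)
Lemma additive_summands (V : zmodType) (f : {additive V -> V})
    (a b c e g h fa fb l d l1 d2 x : V) :
    f a = fa -> f b = fb -> f c = l + d -> f e = l1 + d2 -> f g = d2 ->
    f h = d -> x + l1 *+ 2 + d2 = fa + fb + l ->
  f (a + b + c - e *+ 2 + g - h) = x.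
Proof.
move=> Ea Eb Ec Ee Eg Eh; rewrite raddfB raddfD raddfB raddfMn 2!raddfD.
by rewrite Ea Eb Ec Ee Eg Eh; exact: sub_summands.
Qed.

Lemma catlE p x : catl p x = tsym ^+ p.1 * zsym p.2 * x.
Proof. by []. Qed.

Lemma stuffle_word_cons p q u v : stuffle_word (p :: u) (q :: v) =
  catl p (stuffle_word u (q :: v)) + catl q (stuffle_word (p :: u) v)
  + catl (bmul p q) (stuffle_word u v).
Proof. by case: p q => [m a] [k b]. Qed.

Lemma tstuffle_word_consE p q u v : tstuffle_word (p :: u) (q :: v) =
  catl p (tstuffle_word u (q :: v)) + catl q (tstuffle_word (p :: u) v)
  + (1 - 2 *: tsym) * tsym ^+ (bmul p q).1 * zsym (bmul p q).2
    * tstuffle_word u v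
  + (tsym ^+ 2 - tsym) * tsym ^+ (bmul p q).1
    * dia (0%N, (bmul p q).2) (tstuffle_word u v).
Proof. by case: p q => [m a] [k b]. Qed.

Lemma tstuffle_word_nilr u : tstuffle_word u [::] = wd u.
Proof. by case: u => [|[m a] u]. Qed.

Lemma stuffle_word_nill v : stuffle_word [::] v = wd v.
Proof. by []. Qed.

Lemma stuffle_word_nilr u : stuffle_word u [::] = wd u.
Proof. by case: u => [|[m a] u]. Qed.

Lemma tstuffle_word_nill v : tstuffle_word [::] v = wd v.
Proof. by []. Qed.

(* Keeps unification from unfolding down to the monoid algebra. *)
Opaque wd catl dia bilin_ext stuffle_word tstuffle_word interp.

(** * Linearity of composite expressions *)

Section LinearClosure.
Variables (f g : freeAlg -> freeAlg).
Hypotheses (lf : linear f) (lg : linear g).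

Lemma linear_idfun : linear (fun x : freeAlg => x).
Proof. by []. Qed.

Lemma linear_addf : linear (fun x => f x + g x).
Proof. by move=> c x y; rewrite lf lg scalerDr addrACA. Qed.

Lemma linear_scalef a : linear (fun x => a *: f x).
Proof. by move=> c x y; rewrite lf scalerDr !scalerA mulrC. Qed.

Lemma linear_compf (h : {linear freeAlg -> freeAlg}) :
  linear (fun x => h (f x)).
Proof. by move=> c x y; rewrite lf linearP. Qed.

Lemma linear_bilinl h y : linear (fun x => bilin_ext h (f x) y).
Proof. by move=> c u v; rewrite lf bilin_ext_linearl. Qed.

Lemma linear_bilinr h y : linear (fun x => bilin_ext h y (f x)).
Proof. by move=> c u v; rewrite lf bilin_ext_linearr. Qed.

End LinearClosure.

Lemma linear_catlf p (f : freeAlg -> freeAlg) :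
  linear f -> linear (fun x => catl p (f x)).
Proof. by move=> lf; apply: linear_compf. Qed.

Lemma linear_diaf p (f : freeAlg -> freeAlg) :
  linear f -> linear (fun x => dia p (f x)).
Proof. by move=> lf; apply: linear_compf. Qed.

Lemma linear_interpf (f : freeAlg -> freeAlg) :
  linear f -> linear (fun x => interp (f x)).
Proof. by move=> lf; apply: linear_compf. Qed.

Ltac linear_tac := repeat first
  [ exact: linear_idfun | apply: linear_addf
  | apply: linear_scalef | apply: linear_catlf | apply: linear_diaf
  | apply: linear_interpf
  | apply: linear_bilinl | apply: linear_bilinr ].

Lemma eq_spanned2 (D : pred (seq block)) (f g : freeAlg -> freeAlg -> freeAlg) :
    (forall y, linear (f^~ y)) -> (forall y, linear (g^~ y)) ->
    (forall x, linear (f x)) -> (forall x, linear (g x)) ->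
    (forall u v, D u -> D v -> f (wd u) (wd v) = g (wd u) (wd v)) ->
  forall x y, spanned D x -> spanned D y -> f x y = g x y.
Proof.
move=> lf lg rf rg fg x y Dx Dy.
apply: (eq_spanned (lf y) (lg y)) Dx => u Du.
by apply: (eq_spanned (rf _) (rg _)) Dy => v Dv; exact: fg.
Qed.

(** * The stuffle product *)

Lemma stuffle_wd u v : stuffle (wd u) (wd v) = stuffle_word u v.
Proof. exact: bilin_ext_wd. Qed.

(** Used for all words and for admissible ones. Words of the product start with p, q or pq;
    membership in [D] is decided by the first block, and the blocks pq are always allowed. *)
Lemma spanned_stuffle_word (D : pred (seq block)) u v :
    (D [::]) -> (forall p s t, D (p :: s) -> D (p :: t)) ->
    (forall p q s, D (bmul p q :: s)) -> D u -> D v ->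
  spanned D (stuffle_word u v).
Proof.
move=> D0 Dcons Dmul Du Dv.
(* The tails behind the first block need only be spanned by arbitrary words, so that case comes
   first. *)
have HT : forall u v, spannedT (stuffle_word u v).
  move=> {D D0 Dcons Dmul u v Du Dv}; elim=> [|p u IHu] v.
    exact: spanned_wd.
  elim: v => [|q v IHv]; first by rewrite stuffle_word_nilr; exact: spanned_wd.
  rewrite stuffle_word_cons.
  by apply: spannedD; [apply: spannedD|]; apply: spanned_catl.
case: u v Du Dv => [|p u] [|q v] Du Dv; rewrite ?stuffle_word_nilr;
  try exact: spanned_wd.
rewrite stuffle_word_cons.
apply: spannedD; first apply: spannedD; apply: spanned_catl => // s.
- exact: Dcons Du.
- exact: Dcons Dv.
Qed.

Definition addt p x := catl p x + dia (tmul p) x.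

Lemma stuffle_addt p q x y : spannedT x -> spannedT y ->
  stuffle (addt p x) (addt q y) + catl (tmul (bmul p q)) (stuffle x y) *+ 2
    + dia (tmul (tmul (bmul p q))) (stuffle x y) =
  addt p (stuffle x (addt q y)) + addt q (stuffle (addt p x) y)
    + catl (bmul p q) (stuffle x y).
Proof.
(* The multiple by 2 becomes a scaling, a form that [linear_tac] recognises. *)
rewrite -!scaler_nat /stuffle /addt.
apply: (@eq_spanned2 xpredT
  (fun x y => bilin_ext stuffle_word (catl p x + dia (tmul p) x)
                (catl q y + dia (tmul q) y)
     + 2 *: catl (tmul (bmul p q)) (bilin_ext stuffle_word x y)
     + dia (tmul (tmul (bmul p q))) (bilin_ext stuffle_word x y))
  (fun x y => catl p (bilin_ext stuffle_word x (catl q y + dia (tmul q) y))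
     + dia (tmul p) (bilin_ext stuffle_word x (catl q y + dia (tmul q) y))
     + (catl q (bilin_ext stuffle_word (catl p x + dia (tmul p) x) y)
        + dia (tmul q) (bilin_ext stuffle_word (catl p x + dia (tmul p) x) y))
     + catl (bmul p q) (bilin_ext stuffle_word x y))) => [z|z|z|z|u v _ _].
1-4: by linear_tac.
rewrite scaler_nat.
apply: (@stuffle_addt_words _ bmul tmul freeAlg wd catl dia
  (bilin_ext stuffle_word)).
- by move=> b c d; rewrite bmulA.
- exact: bmulC.
- exact: bmul_tr.
- by move=> b; exact: linearD.
- by move=> b; exact: linearD.
- move=> c a b; have := bilin_ext_linearl stuffle_word c 1 a b.
  by rewrite !scale1r.
- move=> c a b; have := bilin_ext_linearr stuffle_word c 1 a b.
  by rewrite !scale1r.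
- exact: catl_wd.
- exact: dia_wd.
- exact: dia_nil.
- move=> b c u' v'; rewrite bilin_ext_wd; apply: dia_catl.
  exact: spanned_stuffle_word.
- by move=> v'; rewrite bilin_ext_wd.
- by move=> v'; rewrite bilin_ext_wd stuffle_word_nilr.
- by move=> b c u' v'; rewrite !bilin_ext_wd stuffle_word_cons.
Qed.

(** * The interpolated product *)

Lemma tsym_catl k p x : tsym ^+ k * catl p x = catl ((k + p.1)%N, p.2) x.
Proof. by rewrite !catlE /= exprD !mulrA. Qed.

Lemma tsym_dia k p x : tsym ^+ k * dia p x = dia ((k + p.1)%N, p.2) x.
Proof.
have ml : linear (fun y : freeAlg => tsym ^+ k * y).
  by move=> c u v; rewrite mulrDr mulr_scaler.
pose M : {linear freeAlg -> freeAlg} :=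
  HB.pack (fun y : freeAlg => tsym ^+ k * y)
    (GRing.isLinear.Build _ _ _ _ _ ml).
rewrite -[LHS]/(M (dia p x)) !diaE lin_ext_comp.
apply: eq_lin_ext => -[|q s] /=; first by rewrite mulr0.
by rewrite -!catl_wd tsym_catl /= addnA.
Qed.

(** Here [c m] and [d m] stand for L and D of the block t^m z_a, applied to [w]. Multiplication by t
    raises the exponent, so the coefficients 1 - 2t and t^2 - t become shifts of the index. *)
Lemma expand_coefs (A : lalgType rat) (t : A) (x z w : A) (c d : nat -> A) n :
    (forall k m, t ^+ k * c m = c (k + m)%N) ->
    (forall k m, t ^+ k * d m = d (k + m)%N) -> c n = t ^+ n * z * w ->
  x + (1 - 2 *: t) * t ^+ n * z * w + (t ^+ 2 - t) * t ^+ n * d 0%N =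
  x + c n - c n.+1 *+ 2 + d n.+2 - d n.+1.
Proof.
move=> tc td cn; have -> : c n.+1 = t ^+ n.+1 * z * w.
  by rewrite -[n.+1]add1n -tc cn expr1 !mulrA exprS.
have -> : d n.+1 = t * t ^+ n * d 0%N by rewrite -exprS td addn0.
have -> : d n.+2 = t ^+ 2 * t ^+ n * d 0%N by rewrite -exprD td addn0.
rewrite cn !mulrBl mul1r -!scalerAl scaler_nat -exprS.
by rewrite !addrA.
Qed.

(** In this form S can be applied to each summand. *)
Lemma tstuffle_word_cons p q u v : tstuffle_word (p :: u) (q :: v) =
  catl p (tstuffle_word u (q :: v)) + catl q (tstuffle_word (p :: u) v)
  + catl (bmul p q) (tstuffle_word u v)
  - catl (tmul (bmul p q)) (tstuffle_word u v) *+ 2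
  + dia (tmul (tmul (bmul p q))) (tstuffle_word u v)
  - dia (tmul (bmul p q)) (tstuffle_word u v).
Proof.
rewrite tstuffle_word_consE; move: (tstuffle_word u v) (bmul p q) => w [n a].
apply: (@expand_coefs freeAlg tsym _ (zsym a) w
  (fun m => catl (m, a) w) (fun m => dia (m, a) w)) => [k m|k m|].
- exact: tsym_catl.
- exact: tsym_dia.
- exact: catlE.
Qed.

Ltac spanned_tac := repeat match goal with
  | |- spanned _ (_ - _) => apply: spannedB
  | |- spanned _ (_ + _) => apply: spannedD
  | |- spanned _ (_ *: _) => apply: spannedZ
  | |- spanned _ (catl _ _) => apply: spanned_catl
  | |- spanned _ (dia _ _) => apply: spanned_dia
  end.

Lemma spanned_tstuffle_word (D : pred (seq block)) u v :
    (D [::]) -> (forall p s t, D (p :: s) -> D (p :: t)) ->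
    (forall p q s, D (bmul p q :: s)) -> D u -> D v ->
  spanned D (tstuffle_word u v).
Proof.
move=> D0 Dcons Dmul Du Dv.
(* A factor t moves into q, so these blocks are again diamond products. *)
have Dt p q s : D (tmul (bmul p q) :: s) by rewrite -bmul_tr.
have Dtt p q s : D (tmul (tmul (bmul p q)) :: s) by rewrite -!bmul_tr.
have HT : forall u v, spannedT (tstuffle_word u v).
  move=> {D D0 Dcons Dmul u v Du Dv Dt Dtt}; elim=> [|p u IHu] v.
    exact: spanned_wd.
  elim: v => [|q v IHv]; first by rewrite tstuffle_word_nilr; exact: spanned_wd.
  rewrite tstuffle_word_cons -scaler_nat.
  by spanned_tac.
case: u v Du Dv => [|p u] [|q v] Du Dv; rewrite ?tstuffle_word_nilr;
  try exact: spanned_wd.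
rewrite tstuffle_word_cons -scaler_nat.
have Hu s : D (p :: s) := Dcons _ _ _ Du.
have Hv s : D (q :: s) := Dcons _ _ _ Dv.
by spanned_tac => // r s; rewrite -!bmul_tr bmulA; exact: Dmul.
Qed.

Lemma interp_catl p x : spannedT x -> interp (catl p x) = addt p (interp x).
Proof. by move=> Hx; rewrite !interpE interpc_catl // scale1r. Qed.

Lemma interp_dia p x : interp (dia p x) = dia p (interp x).
Proof. by rewrite !interpE interpc_dia. Qed.

Lemma spanned_interp x : spannedT x -> spannedT (interp x).
Proof. by rewrite interpE; exact: spanned_interpc. Qed.

Lemma interp_wd_nil : interp (wd [::]) = wd [::].
Proof. by rewrite interpE /interpc lin_ext_wd wd_nil. Qed.

(** Double induction along the recursion of [tstuffle_word]: the induction hypotheses turn each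
    shorter product into a stuffle product of images under S. *)
Lemma interp_tstuffle_word u v :
  interp (tstuffle_word u v) = stuffle (interp (wd u)) (interp (wd v)).
Proof.
elim: u v => [|p u IHu] v.
  rewrite interp_wd_nil tstuffle_word_nill.
  have : spannedT (interp (wd v)) by exact/spanned_interp/spanned_wd.
  apply: (@eq_spanned xpredT idfun (stuffle (wd [::]))) => // [|s _].
    by rewrite /stuffle; linear_tac.
  by rewrite stuffle_wd.
elim: v => [|q v IHv].
  rewrite interp_wd_nil tstuffle_word_nilr.
  have : spannedT (interp (wd (p :: u))) by exact/spanned_interp/spanned_wd.
  apply: (@eq_spanned xpredT idfun (stuffle^~ (wd [::]))) => // [|s _].
    by rewrite /stuffle; linear_tac.
  by rewrite stuffle_wd stuffle_word_nilr.
have HT u' v' : spannedT (tstuffle_word u' v') by exact: spanned_tstuffle_word.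
have HS s : spannedT (interp (wd s)) by exact/spanned_interp/spanned_wd.
have Ew b s : interp (wd (b :: s)) = addt b (interp (wd s)).
  by rewrite -catl_wd interp_catl //; exact: spanned_wd.
rewrite tstuffle_word_cons.
apply: (@additive_summands freeAlg interp).
- by apply: etrans (interp_catl p (HT _ _)) _; apply: f_equal; exact: IHu.
- by apply: etrans (interp_catl q (HT _ _)) _; apply: f_equal; exact: IHv.
- by apply: etrans (interp_catl _ (HT _ _)) _; apply: f_equal; exact: IHu.
- by apply: etrans (interp_catl _ (HT _ _)) _; apply: f_equal; exact: IHu.
- by apply: etrans (interp_dia _ _) _; apply: f_equal; exact: IHu.
- by apply: etrans (interp_dia _ _) _; apply: f_equal; exact: IHu.
(* What remains is the key identity for x = S(u) and y = S(v). *)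
- rewrite (Ew p u) (Ew q v); exact: stuffle_addt.
Qed.

Lemma interp_tstuffle x y : spannedT x -> spannedT y ->
  interp (tstuffle x y) = stuffle (interp x) (interp y).
Proof.
apply: (@eq_spanned2 xpredT (fun x y => interp (bilin_ext tstuffle_word x y))
  (fun x y => bilin_ext stuffle_word (interp x) (interp y)))
  => [z|z|z|z|u v _ _].
1-4: by linear_tac.
apply: etrans (interp_tstuffle_word u v); apply: f_equal; exact: bilin_ext_wd.
Qed.

Lemma h2_stuffle x y : h2 x -> h2 y -> h2 (stuffle x y).
Proof.
move=> Hx Hy; apply: (@spanned_bilin admissible) Hx Hy => u v Du Dv.
by apply: spanned_stuffle_word => // *; exact: admissible_bmul.
Qed.

Lemma h2_tstuffle x y : h2 x -> h2 y -> h2 (tstuffle x y).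
Proof.
move=> Hx Hy; apply: (@spanned_bilin admissible) Hx Hy => u v Du Dv.
by apply: spanned_tstuffle_word => // *; exact: admissible_bmul.
Qed.

(** * Enumeration of the index sequences *)

(* [b = true] gives the strictly and [b = false] the weakly decreasing
   sequences of [n] positive integers bounded by [N]. *)
Fixpoint decr_seqs (b : bool) (n : nat) : nat -> seq (seq nat) :=
  if n is n'.+1 then
    fix decr_n N := if N is N'.+1 then
      decr_n N' ++ [seq N :: l | l <- decr_seqs b n' (if b then N' else N)]
    else [::]
  else fun=> [:: [::]].

Arguments decr_seqs : simpl never.

Definition decr_rel (b : bool) : rel nat := if b then gtn else geq.

Lemma decr_rel_trans b : transitive (decr_rel b).
Proof.
case: b => y x z /= xy yz; first exact: ltn_trans yz xy.
exact: leq_trans yz xy.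
Qed.

Lemma decr_seqsS b n N : decr_seqs b n.+1 N.+1 = decr_seqs b n.+1 N ++
  [seq N.+1 :: l | l <- decr_seqs b n (if b then N else N.+1)].
Proof. by []. Qed.

(** The recursion lists first the sequences bounded by N, then those with head N + 1, whose tail is
    bounded by N in the strict and by N + 1 in the weak case. *)
Lemma mem_decr_seqs b n N l : (l \in decr_seqs b n N) =
  [&& size l == n, sorted (decr_rel b) l, all (ltn 0) l & all (geq N) l].
Proof.
elim: n N l => [|n IHn] N l; first by rewrite inE; case: l.
elim: N l => [|N IHN] l.
  by case: l => [//|[|a] l] /=; rewrite ?andbF.
rewrite decr_seqsS mem_cat IHN; case: l => [|a l].
  by apply/negbTE/mapP => -[].
have -> : (a :: l \in
    [seq N.+1 :: l0 | l0 <- decr_seqs b n (if b then N else N.+1)])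
    = (a == N.+1) && (l \in decr_seqs b n (if b then N else N.+1)).
  apply/mapP/andP => [[l' ? [-> ->]]|[/eqP -> ?]]; [by split|by exists l].
rewrite IHn /= eqSS (path_sortedE (@decr_rel_trans b)).
case: (size l == n) => //=; last by rewrite andbF.
case: (sorted _ l) => //=; last by rewrite !andbF.
case: (all (ltn 0) l) => /=; last by rewrite !andbF.
rewrite !andbT.
have le_all m m' : (m <= m')%N -> all (geq m) l -> all (geq m') l.
  by move=> mm; apply: sub_all => x /= xm; exact: leq_trans mm.
have geqE : all (decr_rel b N.+1) l = all (geq (if b then N else N.+1)) l.
  by apply: eq_all => x; case: b {IHn IHN}.
have decr_le : all (decr_rel b a) l -> all (geq a) l.
  by apply: sub_all => x; case: b {IHn IHN geqE} => //= /ltnW.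
rewrite [(a <= N.+1)%N]leq_eqVlt ltnS /=.
(* For head N + 1 the bound on the tail is the decrease condition itself; a smaller head leaves only
   the first half of the list, and that head bounds the tail. *)
have [->|aN] /= := eqVneq a N.+1.
  rewrite geqE ltnn /= !andbF /=.
  apply/idP/andP => [h|[]//]; split=> //.
  by case: b h {IHn IHN geqE decr_le} => // /le_all ->.
rewrite orbF; case: (leqP a N) => // aleN /=; rewrite ?andbF //.
apply/andP/andP => -[h1 /andP[h2 h3]]; split=> //; rewrite h2 /=.
  exact: le_all h3.
by apply: le_all aleN _; exact: decr_le.
Qed.

Lemma uniq_decr_seqs b n N : uniq (decr_seqs b n N).
Proof.
elim: n N => [//|n IHn]; elim=> [//|N IHN].
rewrite decr_seqsS cat_uniq IHN map_inj_uniq ?IHn ?andbT => [|x y []//].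
apply/hasPn => _ /mapP[l _ ->]; rewrite mem_decr_seqs /=.
by rewrite ltnn !andbF.
Qed.

(** * Truncated multiple sums *)

Section Truncation.
Variables (R : realType) (t : nat -> R).

Definition block_term (p : block) (l : nat) : R :=
  t l ^+ p.1 / l%:R ^+ val p.2.

Lemma block_term_bmul p q l :
  block_term (bmul p q) l = block_term p l * block_term q l.
Proof. by rewrite /block_term /= !exprD invfM mulrACA. Qed.

Lemma block_term_tmul p l : block_term (tmul p) l = t l * block_term p l.
Proof. by rewrite /block_term /= exprS mulrA. Qed.

(** The product of the t_j^sigma_j, read off along the sequence; the agreement is [fsprod_sigma]. *)
Fixpoint tie_weight (l : seq nat) : R :=
  if l is a :: l' then
    (if l' is b :: _ then if a == b then t a else 1 else 1) * tie_weight l'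
  else 1.

Definition trunc_Z (N : nat) (s : seq block) : R :=
  \sum_(l <- decr_seqs true (size s) N) zeta_term t s l.

Definition trunc_Zt (N : nat) (s : seq block) : R :=
  \sum_(l <- decr_seqs false (size s) N) tie_weight l * zeta_term t s l.

Lemma zeta_term_cons p s a l :
  zeta_term t (p :: s) (a :: l) = block_term p a * zeta_term t s l.
Proof. by rewrite /zeta_term /= big_cons. Qed.

Lemma zeta_term_nil : zeta_term t [::] [::] = 1.
Proof. by rewrite /zeta_term big_nil. Qed.

Lemma trunc_Z_nil N : trunc_Z N [::] = 1.
Proof. by rewrite /trunc_Z big_seq1 zeta_term_nil. Qed.

Lemma trunc_Z0 p s : trunc_Z 0 (p :: s) = 0.
Proof. by rewrite /trunc_Z big_nil. Qed.

Lemma trunc_ZS N p s : trunc_Z N.+1 (p :: s) =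
  trunc_Z N (p :: s) + block_term p N.+1 * trunc_Z N s.
Proof.
rewrite /trunc_Z [size _]/= decr_seqsS big_cat big_map mulr_sumr; congr (_ + _).
by apply: eq_bigr => l _; rewrite zeta_term_cons.
Qed.

Lemma trunc_Zt_nil N : trunc_Zt N [::] = 1.
Proof. by rewrite /trunc_Zt big_seq1 zeta_term_nil mulr1. Qed.

Lemma trunc_Zt0 p s : trunc_Zt 0 (p :: s) = 0.
Proof. by rewrite /trunc_Zt big_nil. Qed.

(** The new sequences have head N + 1. Their tail either stays below N + 1, without a tie, or starts
    with N + 1 and gains the factor t_(N+1); the difference of the two truncations collects the
    second kind and vanishes for the empty tail. *)
Lemma trunc_ZtS N p s : trunc_Zt N.+1 (p :: s) = trunc_Zt N (p :: s)
  + block_term p N.+1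
    * (trunc_Zt N s + t N.+1 * (trunc_Zt N.+1 s - trunc_Zt N s)).
Proof.
rewrite {1}/trunc_Zt [size _]/= decr_seqsS big_cat big_map; congr (_ + _).
case: s => [|q s].
  rewrite big_seq1 !trunc_Zt_nil subrr mulr0 addr0 zeta_term_cons.
  by rewrite zeta_term_nil /= !mulr1 mul1r.
rewrite /trunc_Zt [size _]/= decr_seqsS !big_cat !big_map /=.
rewrite addrAC subrr add0r mulrDr !mulr_sumr; congr (_ + _).
  rewrite big_seq [RHS]big_seq; apply: eq_bigr => -[|b l].
    by rewrite mem_decr_seqs.
  rewrite mem_decr_seqs => /and4P[_ _ _ /andP[/= bN _]].
  rewrite zeta_term_cons; case: eqP => [e|_]; last by rewrite mul1r mulrCA.
  by rewrite -e /= ltnn in bN.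
apply: eq_bigr => l _; rewrite zeta_term_cons /= eqxx; ring.
Qed.

(** * Evaluation on the free algebra *)

(** Common form of [Z] and [Zt], which are by conversion its instances at [Z_word t] and
    [Zt_word t]; it also evaluates the truncations. *)
Definition evalw (g : seq block -> R) (x : freeAlg) : R :=
  \sum_(w <- msupp x) ratr x@_w * g (blocks w).

Definition semilin (f : freeAlg -> R) :=
  forall c x y, f (c *: x + y) = ratr c * f x + f y.

Lemma semilin0 f : semilin f -> f 0 = 0.
Proof.
move=> lf; have := lf 1 0 0; rewrite scaler0 addr0 rmorph1 mul1r => e.
by apply: (addrI (f 0)); rewrite addr0 -e.
Qed.

Lemma evalw_semilin g : semilin (evalw g).
Proof.
move=> c x y; rewrite /evalw.
apply: (@msupp_sum_linear R (fun w a => ratr a * g (blocks w))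
  (fun c v => ratr c * v)) => [w a b|u v||w].
- by rewrite rmorphD rmorphM /= mulrDl mulrA.
- by rewrite mulrDr.
- by rewrite mulr0.
- by rewrite raddf0 mul0r.
Qed.

Lemma evalw_wd g s : evalw g (wd s) = g s.
Proof.
Transparent wd.
by rewrite /evalw /wd msuppU1 big_seq_fset1 mcoeffUU rmorph1 mul1r wordK.
Opaque wd.
Qed.

Lemma semilinE f x : semilin f ->
  f x = \sum_(w <- msupp x) ratr x@_w * f << w >>.
Proof.
move=> lf; rewrite [in LHS](monalgE x).
elim: (enum_fset (msupp x)) => [|w r IH]; first by rewrite !big_nil semilin0.
rewrite !big_cons -[x@_w in LHS]mulr1 monalgUZ lf; congr (_ + _); exact: IH.
Qed.

Lemma eq_semilin (D : pred (seq block)) f g : semilin f -> semilin g ->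
  (forall s, D s -> f (wd s) = g (wd s)) -> forall x, spanned D x -> f x = g x.
Proof.
move=> lf lg fg x Dx; rewrite [LHS](semilinE x lf) [RHS](semilinE x lg).
rewrite big_seq [RHS]big_seq; apply: eq_bigr => w /Dx[s Ds ->].
by congr (_ * _); exact: fg.
Qed.

Lemma semilinD f x y : semilin f -> f (x + y) = f x + f y.
Proof. by move=> lf; have := lf 1 x y; rewrite scale1r rmorph1 mul1r. Qed.

Lemma semilin_comp f h : semilin f -> linear h -> semilin (fun x => f (h x)).
Proof. by move=> lf lh c x y; rewrite (lh c x y) lf. Qed.

Lemma semilin_add f g : semilin f -> semilin g -> semilin (fun x => f x + g x).
Proof. by move=> lf lg c x y; rewrite lf lg; ring. Qed.

Lemma semilin_mul a f : semilin f -> semilin (fun x => a * f x).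
Proof. by move=> lf c x y; rewrite lf; ring. Qed.

Lemma semilin_mulr a f : semilin f -> semilin (fun x => f x * a).
Proof. by move=> lf c x y; rewrite lf; ring. Qed.

Lemma evalw_catl0 p x : spannedT x -> evalw (trunc_Z 0) (catl p x) = 0.
Proof.
apply: (@eq_semilin xpredT (fun x => evalw (trunc_Z 0) (catl p x)) (fun=> 0)).
- by apply: semilin_comp (evalw_semilin _) _; exact: linearP.
- by move=> c u v; rewrite mulr0 addr0.
- by move=> s _; rewrite catl_wd evalw_wd trunc_Z0.
Qed.

Lemma evalw_catlS N p x : spannedT x -> evalw (trunc_Z N.+1) (catl p x) =
  evalw (trunc_Z N) (catl p x) + block_term p N.+1 * evalw (trunc_Z N) x.
Proof.
apply: (@eq_semilin xpredT (fun x => evalw (trunc_Z N.+1) (catl p x))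
  (fun x => evalw (trunc_Z N) (catl p x)
    + block_term p N.+1 * evalw (trunc_Z N) x)).
- by apply: semilin_comp (evalw_semilin _) _; exact: linearP.
- apply: semilin_add; last exact/semilin_mul/evalw_semilin.
  by apply: semilin_comp (evalw_semilin _) _; exact: linearP.
- by move=> s _; rewrite catl_wd !evalw_wd trunc_ZS.
Qed.

Lemma evalw_dia0 p x : spannedT x -> evalw (trunc_Z 0) (dia p x) = 0.
Proof.
apply: (@eq_semilin xpredT (fun x => evalw (trunc_Z 0) (dia p x)) (fun=> 0)).
- by apply: semilin_comp (evalw_semilin _) _; exact: linearP.
- by move=> c u v; rewrite mulr0 addr0.
- move=> [|q s] _; first by rewrite dia_nil (semilin0 (evalw_semilin _)).
  by rewrite dia_wd evalw_wd trunc_Z0.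
Qed.

(** D_p multiplies each term by the value of p at the leading index. The terms that are new at N + 1
    have leading index N + 1 and sum to the difference on the right, written with [-1] as a factor
    so that [semilin_mul] applies. *)
Lemma evalw_diaS N p x : spannedT x -> evalw (trunc_Z N.+1) (dia p x) =
  evalw (trunc_Z N) (dia p x)
  + block_term p N.+1 * (evalw (trunc_Z N.+1) x + -1 * evalw (trunc_Z N) x).
Proof.
apply: (@eq_semilin xpredT (fun x => evalw (trunc_Z N.+1) (dia p x))
  (fun x => evalw (trunc_Z N) (dia p x)
  + block_term p N.+1 * (evalw (trunc_Z N.+1) x + -1 * evalw (trunc_Z N) x))).
- by apply: semilin_comp (evalw_semilin _) _; exact: linearP.
- apply: semilin_add.
    by apply: semilin_comp (evalw_semilin _) _; exact: linearP.
  by apply/semilin_mul/semilin_add; [|apply: semilin_mul]; exact: evalw_semilin.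
- move=> [|q s] _.
    rewrite dia_nil !(semilin0 (evalw_semilin _)) !evalw_wd !trunc_Z_nil.
    ring.
  by rewrite dia_wd !evalw_wd !trunc_ZS block_term_bmul; ring.
Qed.

Lemma evalw_add3 g x y z :
  evalw g (x + y + z) = evalw g x + evalw g y + evalw g z.
Proof. by rewrite !(semilinD _ _ (evalw_semilin _)). Qed.

Lemma sum3_eq0 (a b c : R) : a = 0 -> b = 0 -> c = 0 -> a + b + c = 0.
Proof. by move=> -> -> ->; rewrite !addr0. Qed.

(** Here [x], [y] are the truncations at N of two words, [u], [v] those of their tails, and [f], [g]
    the leading blocks evaluated at N + 1. *)
Lemma stuffle_step (a b c a' b' c' x y u v f g : R) :
  a = a' + f * (u * y) -> b = b' + g * (x * v) -> c = c' + f * g * (u * v) ->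
  a' + b' + c' = x * y -> a + b + c = (x + f * u) * (y + g * v).
Proof.
move=> -> -> -> e; have -> : c' = x * y - a' - b' by rewrite -e; ring.
ring.
Qed.

Lemma interp_step (a b a' b' x y s x' y' f r : R) :
  a = a' + f * x -> b = b' + r * f * (y + -1 * x) -> a' + b' = s -> x = x' ->
  y = y' -> a + b = s + f * (x' + r * (y' - x')).
Proof. by move=> -> -> <- <- <-; ring. Qed.

(** Induction on N for all words at once: at N + 1 each summand of the stuffle recurrence gains a
    product of truncations at N, and at 0 all nonempty words vanish. *)
Lemma evalw_stuffle_word N u v :
  evalw (trunc_Z N) (stuffle_word u v) = trunc_Z N u * trunc_Z N v.
Proof.
have HT u' v' : spannedT (stuffle_word u' v') by exact: spanned_stuffle_word.
have nill M v' : evalw (trunc_Z M) (stuffle_word [::] v') =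
    trunc_Z M [::] * trunc_Z M v'.
  by rewrite stuffle_word_nill evalw_wd trunc_Z_nil mul1r.
have nilr M u' : evalw (trunc_Z M) (stuffle_word u' [::]) =
    trunc_Z M u' * trunc_Z M [::].
  by rewrite stuffle_word_nilr evalw_wd trunc_Z_nil mulr1.
elim: N u v => [|N IH] [|p u] [|q v]; try exact: nill; try exact: nilr.
- rewrite stuffle_word_cons; apply: etrans (evalw_add3 _ _ _ _) _.
  rewrite !trunc_Z0 mulr0; apply: sum3_eq0; exact: evalw_catl0 (HT _ _).
- rewrite stuffle_word_cons; apply: etrans (evalw_add3 _ _ _ _) _.
  rewrite !trunc_ZS; apply: stuffle_step.
  + by apply: etrans (evalw_catlS N p (HT _ _)) _; rewrite IH.
  + by apply: etrans (evalw_catlS N q (HT _ _)) _; rewrite IH.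
  + apply: etrans (evalw_catlS N (bmul p q) (HT _ _)) _.
    by rewrite IH block_term_bmul.
  (* The parts truncated at N reassemble to the stuffle product of the full words. *)
  + apply: etrans (IH (p :: u) (q :: v)).
    by rewrite stuffle_word_cons; apply: esym; exact: evalw_add3.
Qed.

Lemma evalw_stuffle N x y : spannedT x -> spannedT y ->
  evalw (trunc_Z N) (stuffle x y) = evalw (trunc_Z N) x * evalw (trunc_Z N) y.
Proof.
move=> Hx Hy.
apply: (@eq_semilin xpredT (fun x => evalw (trunc_Z N) (stuffle x y))
  (fun x => evalw (trunc_Z N) x * evalw (trunc_Z N) y)) Hx => [||u _].
- apply: semilin_comp (evalw_semilin _) _; exact: bilin_ext_linearl.
- exact/semilin_mulr/evalw_semilin.
apply: (@eq_semilin xpredT (fun y => evalw (trunc_Z N) (stuffle (wd u) y))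
  (fun y => evalw (trunc_Z N) (wd u) * evalw (trunc_Z N) y)) Hy => [||v _].
- apply: semilin_comp (evalw_semilin _) _; exact: bilin_ext_linearr.
- exact/semilin_mul/evalw_semilin.
by rewrite stuffle_wd !evalw_wd evalw_stuffle_word.
Qed.

(** Induction on the word, then on N: the recurrences for L_p and D_(tp) add up to the one of
    [trunc_ZtS]. *)
Lemma evalw_interp N x : spannedT x ->
  evalw (trunc_Z N) (interp x) = evalw (trunc_Zt N) x.
Proof.
apply: (@eq_semilin xpredT (fun x => evalw (trunc_Z N) (interp x))).
- apply: semilin_comp (evalw_semilin _) _; exact: linearP.
- exact: evalw_semilin.
move=> s _; rewrite (evalw_wd _ s); elim: s N => [|p s IHs] N.
  by rewrite interp_wd_nil evalw_wd trunc_Z_nil trunc_Zt_nil.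
have Hw : spannedT (wd s) by exact: spanned_wd.
have Hs : spannedT (interp (wd s)) by exact: spanned_interp.
have -> : interp (wd (p :: s)) = addt p (interp (wd s)).
  by rewrite -catl_wd; exact: interp_catl.
elim: N => [|N IHN]; apply: etrans (semilinD _ _ (evalw_semilin _)) _.
  rewrite trunc_Zt0 -[RHS]addr0; congr (_ + _).
    exact: evalw_catl0.
  exact: evalw_dia0.
rewrite trunc_ZtS; apply: interp_step (IHs N) (IHs N.+1).
- exact: evalw_catlS.
- by apply: etrans (evalw_diaS N (tmul p) Hs) _; rewrite block_term_tmul.
- by apply: etrans IHN; apply: esym; exact: semilinD (evalw_semilin _).
Qed.

End Truncation.

(** * Unconditional sums *)

Lemma ler_sum_sub (R : realDomainType) (T : eqType) (r1 r2 : seq T)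
    (g : T -> R) :
  uniq r1 -> uniq r2 -> {subset r1 <= r2} -> (forall x, x \in r2 -> 0 <= g x) ->
  \sum_(x <- r1) g x <= \sum_(x <- r2) g x.
Proof.
move=> u1 u2 s12 g0; have p : perm_eq r1 [seq x <- r2 | x \in r1].
  apply: uniq_perm => //; first exact: filter_uniq.
  by move=> x; rewrite mem_filter; case: (boolP (x \in r1)) => // /s12 ->.
rewrite (perm_big _ p) /= big_filter [X in _ <= X](bigID (mem r1)) /= lerDl.
by rewrite big_seq_cond sumr_ge0 // => x /andP[xr _]; exact: g0.
Qed.

#[local] Existing Instance totally_filter.

Section Unconditional.
Variables (R : realType) (T : choiceType) (G : nat -> {fset T}).
Hypothesis (G_mono : forall N M, (N <= M)%N -> (G N `<=` G M)%fset).
Hypothesis (G_cover : forall x, exists N, x \in G N).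

Lemma fsub_exhaustion (A : {fset T}) : exists N, (A `<=` G N)%fset.
Proof.
have [n nP] := choice G_cover.
exists (\max_(x <- A) n x)%N; apply/fsubsetP => x xA.
by apply: fsubsetP (nP x); apply: G_mono; exact: leq_bigmax_seq.
Qed.

Lemma partial_sumE (g : T -> R^o) (A : {fset T}) :
  partial_sum g A = \sum_(x <- A) g x.
Proof. by rewrite big_seq_fsetE. Qed.

(** The sums over [G N] increase and are bounded. A finite set containing [G N] lies in some [G M],
    so its sum is squeezed between the one over [G N] and the limit. *)
Lemma totally_cvg_ge0 (g : T -> R^o) (C : R) : (forall x, 0 <= g x :> R) ->
    (forall N, \sum_(x <- G N) g x <= C :> R) ->
  exists L : R^o, partial_sum g (G N) @[N --> \oo] --> L /\
    partial_sum g @ totally --> L.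
Proof.
move=> g0 gC; pose u N : R := partial_sum g (G N).
have le_sub (A B : {fset T}) : (A `<=` B)%fset ->
    (partial_sum g A : R) <= partial_sum g B.
  move=> AB; rewrite !partial_sumE; apply: ler_sum_sub => //.
  exact: fsubsetP.
have u_nd : nondecreasing_seq u by move=> N M NM; apply: le_sub; exact: G_mono.
have u_cvg : cvgn u.
  apply: nondecreasing_is_cvgn => //; exists C => _ [N _ <-].
  by rewrite /u partial_sumE.
exists (limn u); split; first exact: u_cvg.
apply/cvgrPdist_lt => e e0.
have [N _ Ne] : \forall N \near \oo, `|limn u - u N| < e.
  by move/cvgrPdist_lt: (u_cvg : u @ \oo --> limn u); apply.
exists (G N) => // A /= NA; have [M AM] := fsub_exhaustion A.
have SA : (partial_sum g A : R) <= limn u.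
  exact: le_trans (le_sub _ _ AM) (nondecreasing_cvgn_le u_nd u_cvg M).
have uA : u N <= (partial_sum g A : R) by exact: le_sub.
have := Ne N (leqnn N).
rewrite ger0_norm ?subr_ge0 ?(le_trans uA) // => lt_e.
rewrite ger0_norm ?subr_ge0 //; apply: le_lt_trans lt_e.
by rewrite lerD2l lerN2.
Qed.

Lemma sum_exhaustion (f : T -> R^o) (C : R) :
    (forall N, \sum_(x <- G N) `|f x : R| <= C) ->
  partial_sum f (G N) @[N --> \oo] --> (sum f : R^o).
Proof.
(* f is the difference of the nonnegative families f + |f| and |f|, with sums bounded by 2C and
   C. *)
move=> fC; pose h x : R^o := f x + `|f x|; pose k x : R^o := `|f x|.
have [|//|K [K1 K2]] := @totally_cvg_ge0 k C.
  by move=> x; exact: normr_ge0.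
have [||H [H1 H2]] := @totally_cvg_ge0 h (C + C).
- by move=> x; rewrite /h -lerBlDl sub0r -normrN ler_norm.
- move=> N; apply: le_trans (lerD (fC N) (fC N)); rewrite -big_split /=.
  by apply: ler_sum => x _; rewrite lerD2r ler_norm.
have fE A : partial_sum f A = partial_sum h A - partial_sum k A.
  by rewrite !partial_sumE -sumrB; apply: eq_bigr => x _; rewrite /h /k addrK.
have -> : (sum f : R^o) = H - K.
  rewrite /sum; apply: cvg_lim => //.
  rewrite (_ : partial_sum f = partial_sum h \- partial_sum k);
    last exact/funext.
  exact: cvgB.
under eq_fun do rewrite fE.
exact: cvgB.
Qed.

End Unconditional.

(** Bridges the subtype over which [sum] ranges and the truncations, which list elements of the
    ambient type. *)
Lemma sum_exhaustion_sub (R : realType) (K : choiceType) (P : pred K)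
    (f : K -> R) (F : nat -> seq K) (C : R) :
    (forall N, uniq (F N)) -> (forall N, {subset F N <= P}) ->
    (forall N M, (N <= M)%N -> {subset F N <= F M}) ->
    (forall x, P x -> exists N, x \in F N) ->
    (forall N, \sum_(x <- F N) `|f x| <= C) ->
  \sum_(x <- F N) f x @[N --> \oo] -->
    (sum (fun l : {x : K | P x} => f (val l) : R^o) : R).
Proof.
move=> Fu FP Fm Fc FC.
pose G N : {fset {x : K | P x}} := [fset x in pmap insub (F N)]%fset.
have memG N (x : {x : K | P x}) : (x \in G N) = (val x \in F N).
  by rewrite in_fset /= mem_pmap_sub.
have GE N (h : K -> R) : \sum_(x <- G N) h (val x) = \sum_(x <- F N) h x.
  rewrite -(big_map val xpredT h); apply: perm_big; apply: uniq_perm => //.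
    by rewrite map_inj_uniq ?fset_uniq //; exact: val_inj.
  move=> x; apply/mapP/idP => [[y yG ->]|xF]; first by rewrite -memG.
  by exists (exist _ x (FP _ _ xF)); rewrite ?memG.
rewrite (_ : (fun N => _) =
    fun N => partial_sum (fun l : {x : K | P x} => f (val l) : R^o) (G N)).
  apply: (@sum_exhaustion R _ G _ _ (fun l => f (val l)) C).
  - by move=> N M NM; apply/fsubsetP => x; rewrite !memG; exact: Fm.
  - by move=> x; have [N] := Fc _ (valP x); exists N; rewrite memG.
  - by move=> N; rewrite (GE N (fun x => `|f x|)).
by apply/funext => N; rewrite partial_sumE (GE N f).
Qed.

(** * The weight of ties *)

Lemma sigma_cons2 j a b l :
  sigma j [:: a, b & l] = ((a == j) && (b == j) + sigma j (b :: l))%N.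
Proof.
rewrite /sigma -!sum1_card !big_mkcond /= big_ord_recl /=; congr addn.
by rewrite [RHS]big_mkcond; apply: eq_bigr => i _; rewrite !inE.
Qed.

Lemma sigma_notin j l : j \notin l -> sigma j l = 0%N.
Proof.
elim: l => [|a [|b l] IH] jl; try by rewrite /sigma eq_card0 // => -[].
rewrite sigma_cons2 IH; last by move: jl; rewrite inE negb_or => /andP[].
by move: jl; rewrite !inE eq_sym; case: eqP.
Qed.

Section Ties.
Variables (R : realType) (t : nat -> R).

Lemma prod_sigma (r l : seq nat) : uniq r -> {subset l <= r} ->
  \prod_(j <- r) t j ^+ sigma j l = tie_weight t l.
Proof.
move=> ur; elim: l => [|a [|b l] IH] lr.
- by rewrite big1 // => j _; rewrite sigma_notin.
- rewrite /= mulr1 big1 // => j _; rewrite /sigma eq_card0 ?expr0 //.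
  by case.
rewrite [RHS]/= -[_ * tie_weight t l]/(tie_weight t (b :: l)) -IH; last first.
  by move=> x xl; apply: lr; rewrite inE xl orbT.
under eq_bigr do rewrite sigma_cons2 exprD.
rewrite big_split /=; congr (_ * _).
(* The leading pair contributes to the product only if it is a tie, and then only at j = b. *)
have [->|ab] := eqVneq a b.
  rewrite (bigD1_seq b) //=; last by apply: lr; rewrite !inE eqxx orbT.
  rewrite eqxx expr1 big1 ?mulr1 // => j /negbTE.
  by rewrite eq_sym => ->; rewrite expr0.
rewrite big1 // => j _; case: eqP => [<-|_] //=.
by rewrite eq_sym (negbTE ab) expr0.
Qed.

Lemma fsprod_sigma (l : seq nat) : all (ltn 0) l ->
  \big[*%R/1]_(j \in [set j | (0 < j)%N]) t j ^+ sigma j l = tie_weight t l.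
Proof.
(* Outside the entries of [l] the exponent is 0, so the product reduces to these entries without
   repetition. *)
move=> /allP l0; rewrite (fsbigE (undup l)).
- rewrite big_seq_cond (eq_bigl (mem (undup l))) => [|j].
    rewrite -big_seq; apply: prod_sigma; rewrite ?undup_uniq // => x.
    by rewrite mem_undup.
  rewrite inE; case: (boolP (j \in undup l)) => // jl; rewrite mem_set //=.
  by apply: l0; rewrite -mem_undup.
- exact: undup_uniq.
- by move=> j /=; rewrite mem_undup; exact: l0.
- by move=> j _; rewrite mem_undup => /sigma_notin ->; rewrite expr0.
Qed.

End Ties.

(** * Absolute convergence *)

Section Majorant.
Variable R : realType.

(** The complete homogeneous symmetric polynomial of degree n in 1, 1/2, ..., 1/N. *)
Definition harm_sum (n N : nat) : R :=
  \sum_(l <- decr_seqs false n N) \prod_(x <- l) x%:R^-1.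

(** The truncated non-strict zeta sum with exponents 2, 1, ..., 1, the worst case among admissible
    words of this length. *)
Definition major_sum (n N : nat) : R :=
  \sum_(l <- decr_seqs false n.+1 N)
    (head 0%N l)%:R^-1 * \prod_(x <- l) x%:R^-1.

Lemma harm_sum0 N : harm_sum 0 N = 1.
Proof. by rewrite /harm_sum big_seq1 big_nil. Qed.

Lemma harm_sumS n N :
  harm_sum n.+1 N.+1 = harm_sum n.+1 N + N.+1%:R^-1 * harm_sum n N.+1.
Proof.
rewrite /harm_sum decr_seqsS big_cat big_map /= mulr_sumr; congr (_ + _).
by apply: eq_bigr => l _; rewrite big_cons.
Qed.

Lemma major_sumS n N : major_sum n N.+1 =
  major_sum n N + N.+1%:R^-1 ^+ 2 * harm_sum n N.+1.
Proof.
rewrite /major_sum decr_seqsS big_cat big_map /= mulr_sumr; congr (_ + _).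
by apply: eq_bigr => l _; rewrite big_cons mulrA.
Qed.

Lemma harm_sum_ge0 n N : 0 <= harm_sum n N.
Proof.
apply: sumr_ge0 => l _; elim/big_rec: _ => // x y _ y0.
by rewrite mulr_ge0 // invr_ge0.
Qed.

(** The bound 1/l^2 <= 2 (1/l - 1/(l+1)) at l = N + 1, scaled by [h]; it drives the telescoping
    below. *)
Lemma tail_step (N : nat) (h : R) : 0 <= h ->
  N.+1%:R^-1 ^+ 2 * h + 2 * h / N.+2%:R <= 2 * h / N.+1%:R.
Proof.
move=> h0; rewrite -subr_ge0.
rewrite (_ : _ - _ = h * N%:R / (N.+1%:R ^+ 2 * N.+2%:R)).
  by rewrite divr_ge0 ?mulr_ge0 ?exprn_ge0.
rewrite -!natr1; field.
have := ler0n R N.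
by move=> N0; apply/andP; split; apply: lt0r_neq0; lra.
Qed.

Lemma major_sum0_le N : major_sum 0 N + 2 / N.+1%:R <= 2.
Proof.
elim: N => [|N IH]; first by rewrite /major_sum big_nil add0r divr1.
rewrite major_sumS harm_sum0.
apply: le_trans IH; rewrite -addrA lerD2l.
by have := @tail_step N 1 ler01; rewrite !mulr1.
Qed.

(* Summation by parts, with 1/l^2 <= 2 (1/l - 1/(l+1)). *)
Lemma major_sumS_le n N :
  major_sum n.+1 N + 2 * harm_sum n.+1 N / N.+1%:R <= 2 * major_sum n N.
Proof.
elim: N => [|N IH].
  by rewrite /major_sum /harm_sum !big_nil !mulr0 mul0r addr0.
rewrite !major_sumS mulrDr.
have step := tail_step N (harm_sum_ge0 n.+1 N.+1).
(* Raising N in [harm_sum] changes the boundary term exactly by the increment of the right-hand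
   side. *)
have harmE : 2 * harm_sum n.+1 N.+1 / N.+1%:R = 2 * harm_sum n.+1 N / N.+1%:R
    + 2 * (N.+1%:R^-1 ^+ 2 * harm_sum n N.+1).
  by rewrite harm_sumS; ring.
rewrite harmE in step.
apply: le_trans (lerD IH (lexx (2 * (N.+1%:R^-1 ^+ 2 * harm_sum n N.+1)))).
by rewrite -!addrA lerD2l.
Qed.

Lemma major_sum_le n N : major_sum n N <= 2 ^+ n.+1.
Proof.
elim: n => [|n IH].
  apply: le_trans (major_sum0_le N); rewrite lerDl; exact: divr_ge0.
rewrite exprS; apply: le_trans (ler_wpM2l _ IH) => //.
apply: le_trans (major_sumS_le n N).
by rewrite lerDl divr_ge0 // mulr_ge0 // harm_sum_ge0.
Qed.

Variable t : nat -> R.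
Hypothesis t_le1 : forall j, (0 < j)%N -> `|t j| <= 1.

Lemma tie_weight_le1 l : all (ltn 0) l -> `|tie_weight t l| <= 1.
Proof.
elim: l => [|a l IH] /=; first by rewrite normr1.
move=> /andP[a0 /IH l1]; rewrite normrM mulr_ile1 //.
case: l {IH l1} => [|b l]; rewrite ?normr1 //.
by case: ifP; rewrite ?normr1 ?t_le1.
Qed.

(** Applied with k = 1 to arbitrary blocks and with k = 2 to the leading block of an admissible
    word. *)
Lemma block_term_le p a k : (0 < a)%N -> (k <= val p.2)%N ->
  `|block_term t p a| <= a%:R^-1 ^+ k.
Proof.
move=> a0 kp; rewrite /block_term normrM normfV !normrX.
rewrite (ger0_norm (ler0n R a)) -exprVn -[leRHS]mul1r.
apply: ler_pM; rewrite ?exprn_ge0 ?invr_ge0 //.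
  by rewrite exprn_ile1 // t_le1.
apply: ler_wiXn2l => //; rewrite ?invr_ge0 // invf_le1 ?ltr0n //.
by rewrite ler1n.
Qed.

Lemma zeta_term_le s l : size l = size s -> all (ltn 0) l ->
  `|zeta_term t s l| <= \prod_(x <- l) x%:R^-1.
Proof.
elim: s l => [|p s IH] [|a l] //= => [_ _|[sz] /andP[a0 l0]].
  by rewrite zeta_term_nil big_nil normr1.
rewrite zeta_term_cons big_cons normrM; apply: ler_pM => //; last exact: IH.
by rewrite -[leRHS]expr1 block_term_le //; exact: (valP p.2).
Qed.

Lemma zeta_term_admissible_le p s l : admissible (p :: s) ->
    size l = size (p :: s) -> all (ltn 0) l ->
  `|zeta_term t (p :: s) l| <= (head 0%N l)%:R^-1 * \prod_(x <- l) x%:R^-1.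
Proof.
case: l => [//|a l] adm [sz] /= /andP[a0 l0].
rewrite zeta_term_cons big_cons normrM mulrA -expr2; apply: ler_pM => //.
  apply: block_term_le => //; case: p adm => m [i i0] /=; lia.
exact: zeta_term_le.
Qed.

(** The weight [c] is 1 for Z and [tie_weight] for Z^t, so one bound serves both. *)
Lemma abs_sum_bounded b s (c : seq nat -> R) : admissible s ->
    (forall l, all (ltn 0) l -> `|c l| <= 1) ->
  exists C, forall N,
    \sum_(l <- decr_seqs b (size s) N) `|c l * zeta_term t s l| <= C.
Proof.
case: s => [|p s] adm c1.
  exists 1 => N; rewrite big_seq1 zeta_term_nil mulr1; exact: c1.
exists (2 ^+ (size s).+1) => N; apply: le_trans (major_sum_le (size s) N).
apply: (@le_trans _ _ (\sum_(l <- decr_seqs b (size s).+1 N)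
    (head 0%N l)%:R^-1 * \prod_(x <- l) x%:R^-1)).
  rewrite big_seq [leRHS]big_seq; apply: ler_sum => l.
  rewrite mem_decr_seqs => /and4P[/eqP sz _ l0 _].
  rewrite normrM -[leRHS]mul1r; apply: ler_pM => //; first exact: c1.
  exact: zeta_term_admissible_le.
(* Strictly decreasing sequences are among the weakly decreasing ones, and the majorant is
   nonnegative. *)
apply: ler_sum_sub; rewrite ?uniq_decr_seqs // => l.
- rewrite !mem_decr_seqs => /and4P[-> sl -> ->]; rewrite !andbT /=.
  by case: b sl => //; apply: sub_sorted => x y /ltnW.
- move=> _; rewrite mulr_ge0 ?invr_ge0 //.
  by elim/big_rec: _ => // x y _ y0; rewrite mulr_ge0 // invr_ge0.
Qed.

Lemma decr_seqs_mono b n N M : (N <= M)%N ->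
  {subset decr_seqs b n N <= decr_seqs b n M}.
Proof.
move=> NM l; rewrite !mem_decr_seqs => /and4P[-> -> -> lN] /=.
by apply: sub_all lN => x /= xN; exact: leq_trans NM.
Qed.

Lemma decr_seqs_cover b n l :
  [&& size l == n, sorted (decr_rel b) l & all (ltn 0) l] ->
  exists N, l \in decr_seqs b n N.
Proof.
move=> /and3P[sz sl l0]; exists (\max_(x <- l) x)%N.
rewrite mem_decr_seqs sz sl l0 /=; apply/allP => x xl.
exact: (@leq_bigmax_seq _ _ xpredT id).
Qed.

Lemma sub_decr_seqs b n N : {subset decr_seqs b n N <=
  [pred l | [&& size l == n, sorted (decr_rel b) l & all (ltn 0) l]]}.
Proof. by move=> l; rewrite mem_decr_seqs inE => /and4P[-> -> ->]. Qed.

Lemma trunc_Z_cvg s : admissible s ->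
  trunc_Z t N s @[N --> \oo] --> Z_word t s.
Proof.
move=> adm; have [|C CP] := @abs_sum_bounded true s (fun=> 1) adm.
  by move=> l _; rewrite normr1.
apply: (@sum_exhaustion_sub R _
  (fun l => [&& size l == size s, sorted gtn l & all (ltn 0) l])
  (zeta_term t s) (decr_seqs true (size s)) C).
- exact: uniq_decr_seqs.
- exact: (@sub_decr_seqs true).
- exact: decr_seqs_mono.
- exact: (@decr_seqs_cover true).
- by move=> N; apply: le_trans (CP N); apply: ler_sum => l _; rewrite mul1r.
Qed.

Lemma trunc_Zt_cvg s : admissible s ->
  trunc_Zt t N s @[N --> \oo] --> Zt_word t s.
Proof.
move=> adm; have [|C CP] := @abs_sum_bounded false s (tie_weight t) adm.
  exact: tie_weight_le1.
pose P l := [&& size l == size s, sorted geq l & all (ltn 0) l].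
have -> : Zt_word t s =
    sum (fun l : {l : seq nat | P l} =>
      tie_weight t (val l) * zeta_term t s (val l) : R^o).
  rewrite /Zt_word; congr sum; apply/funext => l; congr (_ * _).
  by apply: fsprod_sigma; case/and3P: (valP l).
apply: (@sum_exhaustion_sub R _ P
  (fun l => tie_weight t l * zeta_term t s l) (decr_seqs false (size s)) C).
- exact: uniq_decr_seqs.
- exact: (@sub_decr_seqs false).
- exact: decr_seqs_mono.
- exact: (@decr_seqs_cover false).
- exact: CP.
Qed.

End Majorant.

(** * Passage to the limit and conclusion *)

Lemma cvg_weighted_sum (R : realType) (I : eqType) (r : seq I) (c : I -> R)
    (h : nat -> I -> R) (h0 : I -> R) :
    (forall i, i \in r -> h N i @[N --> \oo] --> h0 i) ->
  \sum_(i <- r) c i * h N i @[N --> \oo] --> \sum_(i <- r) c i * h0 i.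
Proof.
elim: r => [|i r IH] hh.
  by under eq_fun do rewrite big_nil; rewrite big_nil; exact: cvg_cst.
under eq_fun do rewrite big_cons.
rewrite big_cons; apply: cvgD.
  by apply: cvgMr; apply: hh; rewrite inE eqxx.
by apply: IH => k kr; apply: hh; rewrite inE kr orbT.
Qed.

Lemma evalw_cvg (R : realType) (D : pred (seq block))
    (g : nat -> seq block -> R) (g0 : seq block -> R) x :
    (forall s, D s -> g N s @[N --> \oo] --> g0 s) -> spanned D x ->
  evalw (g N) x @[N --> \oo] --> evalw g0 x.
Proof.
move=> gg Dx; apply: (@cvg_weighted_sum R _ (msupp x)
  (fun w => ratr x@_w) (fun N w => g N (blocks w)) (fun w => g0 (blocks w))).
by move=> w /Dx[s Ds ->]; rewrite wordK; exact: gg.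
Qed.

Theorem theorem4 :
  [/\ linear interp,
      set_bij h2 h2 interp,
      forall x y, h2 x -> h2 y -> h2 (tstuffle x y) /\ h2 (stuffle x y)
    & forall x y, h2 x -> h2 y ->
        interp (tstuffle x y) = stuffle (interp x) (interp y)]
  /\
  forall (R : realType) (t : nat -> R),
    (forall j, (0 < j)%N -> -1 <= t j <= 1) ->
    (forall x, h2 x -> Zt t x = Z t (interp x)) /\
    (forall x y, h2 x -> h2 y -> Zt t (tstuffle x y) = Zt t x * Zt t y).
Proof.
have interp_st x y : h2 x -> h2 y ->
    interp (tstuffle x y) = stuffle (interp x) (interp y).
  by move=> Hx Hy; apply: interp_tstuffle; exact: h2T.
split.
  split; [exact: linearP|exact: interp_bij| |exact: interp_st].
  by move=> x y Hx Hy; split; [exact: h2_tstuffle|exact: h2_stuffle].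
move=> R t t1; have {}t1 j : (0 < j)%N -> `|t j| <= 1.
  by move=> /t1; rewrite ler_norml.
have Z_lim x : h2 x -> evalw (trunc_Z t N) x @[N --> \oo] --> Z t x.
  by apply: evalw_cvg => s; exact: trunc_Z_cvg.
have Zt_lim x : h2 x -> evalw (trunc_Zt t N) x @[N --> \oo] --> Zt t x.
  by apply: evalw_cvg => s; exact: trunc_Zt_cvg.
have h2_interp x : h2 x -> h2 (interp x).
  by rewrite interpE; exact: h2_interpc.
have ZtE x : h2 x -> Zt t x = Z t (interp x).
  (* Both sides are limits of the same sequence, since the truncations agree for every N. *)
  move=> Hx; apply: (cvg_unique _ (Zt_lim x Hx)) => //.
  rewrite -(_ : (fun N => evalw (trunc_Z t N) (interp x)) =
    fun N => evalw (trunc_Zt t N) x).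
    exact: Z_lim (h2_interp _ Hx).
  by apply/funext => N; exact: evalw_interp (h2T Hx).
split=> // x y Hx Hy.
(* As Z^t = Z o S and S is a homomorphism, only the multiplicativity of Z for the stuffle product is
   left; it holds for each truncation and passes to the limit. *)
rewrite (ZtE _ (h2_tstuffle Hx Hy)) (ZtE _ Hx) (ZtE _ Hy) (interp_st _ _ Hx Hy).
move: (h2_interp _ Hx) (h2_interp _ Hy) => {Hx Hy}.
move: (interp x) (interp y) => {}x {}y Hx Hy.
apply: (cvg_unique _ (Z_lim _ (h2_stuffle Hx Hy))) => //.
rewrite (_ : (fun N => _) =
    fun N => evalw (trunc_Z t N) x * evalw (trunc_Z t N) y).
  by apply: cvgM; exact: Z_lim.
by apply/funext => N; exact: evalw_stuffle (h2T Hx) (h2T Hy).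
Qed.
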